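(* Let $\tau$ be a relational vocabulary whose relation symbols are at most binary. For every formula $\phi\in \mathsf{IF}^2(\tau)$ there is a formula $\phi^*\in \mathsf{D}^3(\tau)$ such that for all $\tau$-structures $\mathfrak{A}$ and all teams $X$ of $\mathfrak{A}$ with $\mathrm{dom}(X)=\{x,y\}$, $$\mathfrak{A}\models_X\phi \iff \mathfrak{A}\models_X\phi^*.$$
   Context: Syntax. Formulas of $\mathsf{IF}^2(\tau)$ (two-variable independence-friendly logic, with variables $x,y$) are generated by $\phi::= t_1=t_2\mid R(t_1,\dots,t_n)\mid \neg t_1=t_2\mid \neg R(t_1,\dots,t_n)\mid(\phi\wedge\phi)\mid(\phi\vee\phi)\mid\forall x\phi\mid\forall y\phi\mid\exists x/W\phi\mid\exists y/W\phi$, where $R\in\tau$ is $n$-ary, $t_1,\dots,t_n\in\{x,y\}$ and $W\subseteq\{x,y\}$; $\exists x/\emptyset\,\phi$ is identified with $\exists x\phi$. Formulas of $\mathsf{D}^3(\tau)$ (three-variable dependence logic) are the dependence logic formulas, in negation normal form, in which only the variables $x,y,z$ occur: they are built from first-order literals over $\tau$ (including equality literals), dependence atoms $=\!(t_1,\dots,t_n)$ and negated dependence atoms $\neg =\!(t_1,\dots,t_n)$ with terms in $\{x,y,z\}$, using $\wedge,\vee$ and the quantifiers $\forall v,\exists v$ with $v\in\{x,y,z\}$. Teams. A team $X$ of $\mathfrak{A}$ (domain $A$) with domain $\mathrm{dom}(X)=\{x_1,\dots,x_k\}$ is any set of assignments $\{x_1,\dots,x_k\}\to A$. The assignment $s(a/x)$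 has domain $\mathrm{dom}(s)\cup\{x\}$, maps $x$ to $a$ and agrees with $s$ elsewhere. For $F\colon X\to A$, $X(F/x)=\{s(F(s)/x)\mid s\in X\}$, and $X(A/x)=\{s(a/x)\mid s\in X,a\in A\}$. For $W\subseteq\mathrm{dom}(X)$, $F\colon X\to A$ is $W$-independent if $F(s)=F(s')$ whenever $s,s'\in X$ agree on $\mathrm{dom}(X)\setminus W$. Semantics (the domain of $X$ is assumed to contain the free variables of the formula). (1) For a first-order literal $\phi$: $\mathfrak{A}\models_X\phi$ iff every $s\in X$ satisfies $\phi$ in $\mathfrak{A}$ in the usual sense. (2) $\mathfrak{A}\models_X\psi\wedge\phi$ iff $\mathfrak{A}\models_X\psi$ and $\mathfrak{A}\models_X\phi$. (3) $\mathfrak{A}\models_X\psi\vee\phi$ iff $X=Y\cup Z$ for some teams $Y,Z$ with $\mathfrak{A}\models_Y\psi$ and $\mathfrak{A}\models_Z\phi$. (4) $\mathfrak{A}\models_X\exists v\psi$ iff $\mathfrak{A}\models_{X(F/v)}\psi$ for some $F\colon X\to A$. (5) $\mathfrak{A}\models_X\forall v\psi$ iff $\mathfrak{A}\models_{X(A/v)}\psi$. (6) $\mathfrak{A}\models_X\exists v/W\psi$ iff $\mathfrak{A}\models_{X(F/v)}\psi$ for some $W$-independent $F\colon X\to A$. (7) $\mathfrak{A}\models_X{=}(t_1,\dots,t_n)$ iff any $s,s'\in X$ that give equal values to each of $t_1,\dots,t_{n-1}$ give equal values to $t_n$. (8) $\mathfrak{A}\models_X\neg{=}(t_1,\dots,t_n)$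 iff $X=\emptyset$. *)

(* Defs.v *)
From HB Require Import structures.
From mathcomp Require Import all_boot.
From mathcomp Require Import boolp classical_sets.

Set Implicit Arguments.
Unset Strict Implicit.
Unset Printing Implicit Defensive.

Local Open Scope classical_set_scope.

Inductive var := vx | vy | vz.

Definition ord_of_var (v : var) : 'I_3 :=
  match v with vx => inord 0 | vy => inord 1 | vz => inord 2 end.

Definition var_of_ord (i : 'I_3) : var :=
  match val i with 0 => vx | 1 => vy | _ => vz end.

Lemma ord_of_varK : cancel ord_of_var var_of_ord.
Proof. by case; rewrite /var_of_ord /= inordK. Qed.

HB.instance Definition _ := Finite.copy var (can_type ord_of_varK).

Definition xy : {set var} := [set vx; vy]%SET.

Record vocabulary := Vocabulary {
  symbol :> Type;
  arity : symbol -> nat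
}.

Record structure (tau : vocabulary) := Structure {
  carrier :> Type;
  carrier_nonempty : inhabited carrier;
  interp : forall R : tau, (arity R).-tuple carrier -> Prop
}.

Section Syntax.
Variable tau : vocabulary.

Inductive literal :=
| LEq (t u : var)
| LNeq (t u : var)
| LRel (R : tau) (ts : (arity R).-tuple var)
| LNRel (R : tau) (ts : (arity R).-tuple var).

Definition literal_vars (l : literal) : {set var} :=
  match l with
  | LEq t u | LNeq t u => [set t; u]%SET
  | LRel R ts | LNRel R ts => [set:: ts]%SET
  end.

(* The quantifier exists v is IFEx v set0. *)
Inductive IF_formula :=
| IFLit (l : literal)
| IFAnd (phi psi : IF_formula)
| IFOr (phi psi : IF_formula)
| IFAll (v : var) (phi : IF_formula)
| IFEx (v : var) (W : {set var}) (phi : IF_formula).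

(* Only x and y occur in phi, whether in literals, as quantified variables, or
   in slash sets. *)
Fixpoint is_IF2 (phi : IF_formula) : bool :=
  match phi with
  | IFLit l => literal_vars l \subset xy
  | IFAnd phi psi | IFOr phi psi => is_IF2 phi && is_IF2 psi
  | IFAll v phi => (v \in xy) && is_IF2 phi
  | IFEx v W phi => [&& v \in xy, W \subset xy & is_IF2 phi]
  end.

(* Since var has exactly three elements, these are the three-variable formulas.
   DDep ts t is the dependence atom =(ts, t): the values of ts determine the
   value of t. *)
Inductive D3_formula :=
| DLit (l : literal)
| DDep (ts : seq var) (t : var)
| DNDep (ts : seq var) (t : var)
| DAnd (phi psi : D3_formula)
| DOr (phi psi : D3_formula)
| DAll (v : var) (phi : D3_formula)
| DEx (v : var) (phi : D3_formula).

Fixpoint D3_free (phi : D3_formula) : {set var} :=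
  match phi with
  | DLit l => literal_vars l
  | DDep ts t | DNDep ts t => [set:: rcons ts t]%SET
  | DAnd phi psi | DOr phi psi => (D3_free phi :|: D3_free psi)%SET
  | DAll v phi | DEx v phi => (D3_free phi :\ v)%SET
  end.

End Syntax.

Section Teams.
Variable A : Type.

(* Assignments are partial: s v = None means that v is not in dom(s). *)
Definition assignment := var -> option A.
Definition team := set assignment.

(* The empty team has every domain. *)
Definition has_dom (D : {set var}) (X : team) : Prop :=
  forall s, X s -> forall v, isSome (s v) = (v \in D).

Definition update (s : assignment) (a : A) (v : var) : assignment :=
  fun w => if w == v then Some a else s w.

(* Functions X -> A are represented by functions on all assignments, of which
   only the values on X are used; no generality is lost because A is nonempty
   in every structure. *)
Definition supplement (X : team) (F : assignment -> A) (v : var) : team :=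
  [set update s (F s) v | s in X].

Definition duplicate (X : team) (v : var) : team :=
  [set s' | exists2 s, X s & exists a, s' = update s a v].

(* All members of a team have the same domain, so two of them agree on
   dom(X) \ W iff they agree as partial functions outside W. *)
Definition independent (W : {set var}) (X : team) (F : assignment -> A) : Prop :=
  forall s s', X s -> X s' -> (forall v, v \notin W -> s v = s' v) -> F s = F s'.

End Teams.

Section Semantics.
Variables (tau : vocabulary) (A : structure tau).

(* A literal with a variable outside dom(s) is not satisfied by s. *)
Definition literal_sat (s : assignment A) (l : literal tau) : Prop :=
  match l with
  | LEq t u => exists a b, [/\ s t = Some a, s u = Some b & a = b]
  | LNeq t u => exists a b, [/\ s t = Some a, s u = Some b & a <> b]
  | LRel R ts =>
      exists2 a : (arity R).-tuple A, map s ts = map Some a & interp a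
  | LNRel R ts =>
      exists2 a : (arity R).-tuple A, map s ts = map Some a & ~ interp a
  end.

Definition team_literal_sat (X : team A) (l : literal tau) : Prop :=
  forall s, X s -> literal_sat s l.

Fixpoint IF_sat (X : team A) (phi : IF_formula tau) : Prop :=
  match phi with
  | IFLit l => team_literal_sat X l
  | IFAnd phi psi => IF_sat X phi /\ IF_sat X psi
  | IFOr phi psi =>
      exists Y Z : team A, [/\ X = Y `|` Z, IF_sat Y phi & IF_sat Z psi]
  | IFAll v phi => IF_sat (duplicate X v) phi
  | IFEx v W phi =>
      exists2 F : assignment A -> A,
        independent W X F & IF_sat (supplement X F v) phi
  end.

Fixpoint D3_sat (X : team A) (phi : D3_formula tau) : Prop :=
  match phi with
  | DLit l => team_literal_sat X l
  | DDep ts t =>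
      forall s s', X s -> X s' ->
        (forall u, u \in ts -> s u = s' u) -> s t = s' t
  | DNDep ts t => X = set0
  | DAnd phi psi => D3_sat X phi /\ D3_sat X psi
  | DOr phi psi =>
      exists Y Z : team A, [/\ X = Y `|` Z, D3_sat Y phi & D3_sat Z psi]
  | DAll v phi => D3_sat (duplicate X v) phi
  | DEx v phi => exists F : assignment A -> A, D3_sat (supplement X F v) phi
  end.

End Semantics.

(* Main.v *)
(** Since [x] and [y] are the only variables of the team, a choice of [v] that
    is independent of [W] is first stored in the spare variable [z], where the
    old value of [v] is still available to the dependence atom
    [=(xy \ W, z)], and then copied to [v].  The leftover column [z] is harmless
    because dependence logic is local: satisfaction only depends on the values
    of the free variables. *)

Require Import Defs.
From HB Require Import structures.
From mathcomp Require Import all_boot.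
From mathcomp Require Import boolp classical_sets.
From mathcomp Require Import fintype finset.

Set Implicit Arguments.
Unset Strict Implicit.
Unset Printing Implicit Defensive.

(** The restriction of [Y] to [V] is included in that of [X]. Nothing is asked outside [V], so teams
    with and without the column [z] can be compared. *)
Definition covers (A : Type) (V : {set var}) (X Y : team A) : Prop :=
  forall s, Y s -> exists2 s', X s' & {in V, s =1 s'}.

Section Teams.
Variable A : Type.
Implicit Types (X Y : team A) (V : {set var}).

Lemma update_same (s : assignment A) a v : update s a v v = Some a.
Proof. by rewrite /update eqxx. Qed.

Lemma update_neq (s : assignment A) a v w : w != v -> update s a v w = s w.
Proof. by rewrite /update => /negbTE ->. Qed.

Lemma covers_sub V V' X Y : V \subset V' -> covers V' X Y -> covers V X Y.
Proof.
move=> /subsetP sVV' cXY s /cXY[s' Xs' ss'].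
by exists s' => // v /sVV'; apply: ss'.
Qed.

Lemma update_agree V v (s s' : assignment A) a :
  {in V :\ v, s =1 s'} -> {in V, update s a v =1 update s' a v}.
Proof.
move=> ss' w Vw; rewrite /update; case: eqP => // /eqP wv.
by apply: ss'; rewrite in_setD1 wv.
Qed.

Lemma covers_duplicate V v X Y :
  covers (V :\ v)%SET X Y -> covers V (duplicate X v) (duplicate Y v).
Proof.
move=> cXY _ [s /cXY[s' Xs' ss'] [a ->]].
by exists (update s' a v); [exists s' => //; exists a | exact: update_agree].
Qed.

(** [G] copies the value of [F] at a chosen partner in [X]. Partners need not agree at [v], since
    that value is overwritten. *)
Lemma covers_supplement V v X Y (F : assignment A -> A) :
  covers (V :\ v)%SET X Y ->
  exists G : assignment A -> A, covers V (supplement X F v) (supplement Y G v).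
Proof.
move=> cXY.
have /choice[G GP] (s : assignment A) :
    exists a, Y s -> exists2 s', X s' & {in (V :\ v)%SET, s =1 s'} /\ a = F s'.
  (* Outside [Y] any value will do; [F s] serves as a default. *)
  have [/cXY[s' Xs' ss']|nYs] := pselect (Y s); last by exists (F s).
  by exists (F s') => _; exists s'.
exists G => _ [s Ys <-]; have [s' Xs' [ss' ->]] := GP s Ys.
by exists (update s' (F s') v); [exists s' | exact: update_agree].
Qed.

Lemma has_dom_duplicate V v X :
  v \in V -> has_dom V X -> has_dom V (duplicate X v).
Proof.
move=> Vv dX _ [s Xs [a ->]] w; rewrite /update.
by case: eqP => [->|_]; [rewrite Vv | exact: dX].
Qed.

Lemma has_dom_supplement V v X F :
  v \in V -> has_dom V X -> has_dom V (supplement X F v).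
Proof.
move=> Vv dX _ [s Xs <-] w; rewrite /update.
by case: eqP => [->|_]; [rewrite Vv | exact: dX].
Qed.

End Teams.

Section Locality.
Variables (tau : vocabulary) (A : structure tau).

Lemma literal_sat_local (l : literal tau) (s s' : assignment A) :
  {in literal_vars l, s =1 s'} -> literal_sat s' l -> literal_sat s l.
Proof.
have eq_ts n (ts : n.-tuple var) :
    {in [set:: ts]%SET, s =1 s'} -> map s ts = map s' ts.
  by move=> ss'; apply/eq_in_map => v v_ts; apply: ss'; rewrite inE.
by case: l => [t u|t u|R ts|R ts] /= ss';
  rewrite ?(eq_ts _ ts) // !ss' // !inE eqxx ?orbT.
Qed.

(* With V the set of free variables, this is locality and downward closure at
   once. *)
Lemma D3_sat_covers (phi : D3_formula tau) (X Y : team A) :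
  covers (D3_free phi) X Y -> D3_sat X phi -> D3_sat Y phi.
Proof.
elim: phi X Y => [l|ts t|ts t|phi IHphi psi IHpsi|phi IHphi psi IHpsi
    |v phi IH|v phi IH] X Y /= cXY.
- by move=> satX s /cXY[s' /satX + ss']; apply: literal_sat_local.
- move=> satX s1 s2 /cXY[s1' Xs1 e1] /cXY[s2' Xs2 e2] s12.
  have inl u : u \in ts -> u \in [set:: rcons ts t]%SET.
    by rewrite !inE mem_rcons in_cons => ->; rewrite orbT.
  have inr : t \in [set:: rcons ts t]%SET by rewrite !inE mem_rcons mem_head.
  rewrite (e1 t) // (e2 t) //; apply: satX => // u uts.
  by rewrite -(e1 u) ?inl // -(e2 u) ?inl // s12.
- move=> X0; apply/seteqP; split=> // s /cXY[s'].
  by rewrite X0.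
- move=> [satphi satpsi]; split.
    by apply: IHphi satphi; apply: covers_sub cXY; apply: subsetUl.
  by apply: IHpsi satpsi; apply: covers_sub cXY; apply: subsetUr.
- move=> [X1 [X2 [XE satphi satpsi]]]; set V := (_ :|: _)%SET in cXY.
  (* The splitting of [X] is pulled back to [Y]: [part Z] collects the assignments with a partner in
     [Z]. The two parts may overlap, as the semantics of disjunction allows. *)
  pose part (Z : team A) : team A :=
    fun s => Y s /\ exists2 s', Z s' & {in V, s =1 s'}.
  have cpart Z : covers V Z (part Z) by move=> s [].
  exists (part X1), (part X2); split.
  + apply/seteqP; split=> [s Ys|s [[]|[]] //].
    have [s' + ss'] := cXY s Ys; rewrite XE.
    by case=> Xs'; [left | right]; split=> //; exists s'.
  + by apply: IHphi satphi; apply: covers_sub (cpart X1); apply: subsetUl.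
  + by apply: IHpsi satpsi; apply: covers_sub (cpart X2); apply: subsetUr.
- by apply: IH; apply: covers_duplicate.
- move=> [F satF]; have [G cG] := covers_supplement F cXY.
  by exists G; apply: IH satF.
Qed.

End Locality.

Section SlashedQuantifier.
Variable tau : vocabulary.

Definition slashed_ex (v : var) (W : {set var}) (psi : D3_formula tau) :=
  DEx vz (DAnd (DDep tau (enum (xy :\: W)%SET) vz)
               (DEx v (DAnd (DLit (LEq tau v vz)) psi))).

Lemma vz_notin_xy : vz \notin xy.
Proof. by rewrite !inE; apply/norP; split; apply/eqP. Qed.

Lemma neq_vz v : v \in xy -> v != vz.
Proof. by apply: contraTneq => ->; exact: vz_notin_xy. Qed.

Lemma slashed_ex_free v W psi : v \in xy ->
  D3_free psi \subset xy -> D3_free (slashed_ex v W psi) \subset xy.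
Proof.
move=> vxy /subsetP psi_xy; apply/subsetP => u /=.
rewrite in_setD1 in_setU => /andP[uz /orP[]].
  by rewrite inE mem_rcons in_cons (negbTE uz) mem_enum in_setD => /andP[].
rewrite in_setD1 in_setU in_set2 (negbTE uz) orbF => /andP[uv].
by rewrite (negbTE uv) /=; apply: psi_xy.
Qed.

Lemma slashed_ex_sat (A : structure tau) (X : team A) v W psi :
    v \in xy -> D3_free psi \subset xy -> has_dom xy X ->
  (exists2 F : assignment A -> A,
      independent W X F & D3_sat (supplement X F v) psi) <->
  D3_sat X (slashed_ex v W psi).
Proof.
move=> vxy psi_xy dX; have vz_v : vz != v by rewrite eq_sym neq_vz.
(* On [xy], storing a value in [z] before updating [v] leaves no trace. *)
have agree (s : assignment A) a b :
    {in xy, update (update s b vz) a v =1 update s a v}.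
  by apply: update_agree => w /setD1P[_ wxy]; rewrite update_neq ?neq_vz.
split=> [[F indF satF]|[F [depF [H [eqH satH]]]]].
- exists F; split.
    move=> _ _ [s Xs <-] [s' Xs' <-] ss'; rewrite !update_same.
    congr Some; apply: indF => // w wW.
    have [wxy|wxy] := boolP (w \in xy).
      have := ss' w; rewrite mem_enum in_setD wW wxy => /(_ isT).
      by rewrite !update_neq ?neq_vz.
    (* Outside [xy] both assignments are undefined, so agreement off [W] reduces to agreement on
       [xy] minus [W]. *)
    have := dX s Xs w; have := dX s' Xs' w; rewrite (negbTE wxy).
    by case: (s w); case: (s' w).
  (* The second choice reads the stored value back from [z]; the default is never reached on the
     team at hand, where [z] is defined. *)
  pose H (s : assignment A) := odflt (F s) (s vz).
  have HE s : H (update s (F s) vz) = F s by rewrite /H update_same.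
  exists H; split.
    move=> _ [_ [s Xs <-] <-]; exists (F s), (F s).
    by rewrite HE update_same update_neq // update_same.
  apply: D3_sat_covers satF; apply: covers_sub psi_xy _.
  move=> _ [_ [s Xs <-] <-]; rewrite HE.
  by exists (update s (F s) v); [exists s | exact: agree].
- exists F.
    move=> s s' Xs Xs' ss'.
    (* The column [z] holds the values of [F], so the dependence atom gives its independence of
       [W]. *)
    suff: update s (F s) vz vz = update s' (F s') vz vz.
      by rewrite !update_same => -[].
    apply: depF; [by exists s | by exists s' | move=> u].
    rewrite mem_enum in_setD => /andP[uW uxy].
    by rewrite !update_neq ?neq_vz ?ss'.
  apply: D3_sat_covers satH; apply: covers_sub psi_xy _.
  move=> _ [s Xs <-]; set t := update s (F s) vz.
  have Xt : supplement (supplement X F vz) H v (update t (H t) v).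
    by exists t => //; exists s.
  exists (update t (H t) v) => // w wxy.
  (* The equality literal forces the second choice [H t] to be the stored value [F s]. *)
  have [a [b []]] := eqH _ Xt.
  rewrite update_same update_neq // /t update_same => -[->] [->] ->.
  by rewrite agree.
Qed.

End SlashedQuantifier.

Theorem lemma3p2 (tau : vocabulary) (tau_binary : forall R : tau, arity R <= 2)
    (phi : IF_formula tau) (phi_IF2 : is_IF2 phi) :
  exists phi' : D3_formula tau,
    D3_free phi' \subset xy /\
    forall (A : structure tau) (X : team A), has_dom xy X ->
      (IF_sat X phi <-> D3_sat X phi').
Proof.
(* The bound on the free variables is carried through the induction: in the slashed case the
   translated body must not have [z] free. *)
elim: phi phi_IF2 => [l|phi IHphi psi IHpsi|phi IHphi psi IHpsi
    |v phi IH|v W phi IH] /=.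
- by exists (DLit l).
- move=> /andP[/IHphi[phi' [fphi Ephi]] /IHpsi[psi' [fpsi Epsi]]].
  exists (DAnd phi' psi'); split=> [|A X dX] /=; first by rewrite subUset fphi.
  by rewrite Ephi // Epsi.
- move=> /andP[/IHphi[phi' [fphi Ephi]] /IHpsi[psi' [fpsi Epsi]]].
  exists (DOr phi' psi'); split=> [|A X dX] /=; first by rewrite subUset fphi.
  (* The induction hypotheses apply to [Y] and [Z] because subteams of [X] inherit its domain. *)
  by split=> -[Y [Z [XE satY satZ]]]; exists Y, Z; split=> //;
    [apply/Ephi | apply/Epsi | apply/Ephi | apply/Epsi] => // s ?;
    apply: dX; rewrite XE; [left | right | left | right].
- move=> /andP[vxy /IH[phi' [fphi Ephi]]].
  exists (DAll v phi'); split=> [|A X dX] /=.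
    exact: subset_trans (subsetDl _ _) fphi.
  by apply: Ephi; apply: has_dom_duplicate.
- move=> /and3P[vxy _ /IH[phi' [fphi Ephi]]].
  exists (slashed_ex v W phi'); split=> [|A X dX].
    exact: slashed_ex_free.
  rewrite -slashed_ex_sat //.
  by split=> -[F indF satF]; exists F => //; apply/Ephi => //;
    apply: has_dom_supplement.
Qed.
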